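(* Let $r\ge2$, let $d_1,\dots,d_r\ge2$ be integers, and consider the complex system $$\dot x_i=-2x_iu_i,\quad \dot u_i=-u_iu_{r+1}+\tfrac1{d_i}x_i\quad(1\le i\le r),\qquad \dot x_{r+1}=x_{r+1}u_{r+1},\quad \dot u_{r+1}=-\sum_{k=1}^rd_ku_k^2,$$ with expansions about $t=0$ (with rational exponents) $$x_i=a_{i,0}t^{\alpha_i}+\dots,\quad u_i=c_{i,0}t^{\gamma_i}+\dots\quad(1\le i\le r),\qquad x_{r+1}=b_0t^\beta+\dots,\quad u_{r+1}=e_0t^\epsilon+\dots$$ that are singular at $t=0$, where $1\le l\le r$, $\alpha_i\neq0$ and $\alpha_i>-2$ for $1\le i\le l$, and $\alpha_i=0$ for $l+1\le i\le r$. The leading order terms of such expansions satisfying the leading-order balance are exactly those obtained by setting $$\gamma_i=-1,\quad a_{i,0}\ \text{arbitrary},\quad c_{i,0}=-\alpha_i/2\quad(1\le i\le l),$$ $$\gamma_i=1,\quad a_{i,0}\ \text{arbitrary},\quad c_{i,0}=\frac{a_{i,0}}{2d_i}\quad(l+1\le i\le r),$$ $$b_0\ \text{arbitrary},\quad e_0=1,\quad \beta=1,\quad \epsilon=-1,$$ where the leading exponents $(\alpha_1,\dots,\alpha_l)$ can be taken to be any rational point with nonzero entries on the ellipsoid $d_1\alpha_1^2+\dots+d_l\alpha_l^2=4$ in $\mathbb R^{l}$.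
   Context: Expansions: the leading coefficients $a_{i,0},c_{i,0},b_0,e_0$ are nonzero complex numbers, and dots denote higher powers of $t$. The expansions are singular if at least one of the leading exponents is negative. Leading-order balance: after substitution, the potentially leading terms on the left : right sides of the equations are $$a_{i,0}\alpha_it^{\alpha_i-1} : -2a_{i,0}c_{i,0}t^{\alpha_i+\gamma_i};\qquad b_0\beta t^{\beta-1} : b_0e_0t^{\beta+\epsilon};$$ $$c_{i,0}\gamma_it^{\gamma_i-1} : -c_{i,0}e_0t^{\gamma_i+\epsilon},\ d_i^{-1}a_{i,0}t^{\alpha_i};\qquad e_0\epsilon t^{\epsilon-1} : -d_1c_{1,0}^2t^{2\gamma_1},\dots,-d_rc_{r,0}^2t^{2\gamma_r}$$ ($1\le i\le r$). The balance holds if for each equation, at the smallest exponent of $t$ appearing among the listed monomials of that equation, the total coefficient on the left equals the total coefficient on the right. ''Arbitrary'' means every nonzero value is allowed by the balance. *)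

(* Defs.v *)
From mathcomp Require Import all_boot all_order all_algebra.
From mathcomp Require Import reals.
From mathcomp Require Export complex.

Set Implicit Arguments.
Unset Strict Implicit.
Unset Printing Implicit Defensive.

Import Order.TTheory GRing.Theory Num.Theory.
Local Open Scope ring_scope.

Section Monomials.
Variable C : fieldType.

(* The pair (k, q) stands for the monomial k * t ^ q. A monomial with zero
   coefficient keeps its exponent: the derivative of the leading term of x_i
   when alpha_i = 0 is (0, -1), and it takes part in the minimum below. *)
Definition monomial : Type := (C * rat)%type.

Definition mono_mul (p q : monomial) : monomial := (p.1 * q.1, p.2 + q.2).
Definition mono_scale (k : C) (p : monomial) : monomial := (k * p.1, p.2).
Definition mono_deriv (p : monomial) : monomial := (p.1 * ratr p.2, p.2 - 1).

Definition coef_at (m : rat) (s : seq monomial) : C :=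
  \sum_(p <- s | p.2 == m) p.1.

Definition min_exponent (p : monomial) (s : seq monomial) : rat :=
  \big[Order.min/p.2]_(q <- s) q.2.

Definition balanced (lhs : monomial) (rhs : seq monomial) : Prop :=
  let m := min_exponent lhs rhs in coef_at m [:: lhs] = coef_at m rhs.

End Monomials.

(* The system
     dx_i/dt = - 2 x_i u_i,        du_i/dt = - u_i u_(r+1) + x_i / d_i,
     dx_(r+1)/dt = x_(r+1) u_(r+1),  du_(r+1)/dt = - \sum_k d_k u_k ^ 2
   after substitution of the leading terms x i, u i of x_(i+1), u_(i+1) and
   x', u' of x_(r+1), u_(r+1): each rhs_* lists one monomial in t per monomial
   of the right-hand side. *)
Section System.
Variables (C : fieldType) (r : nat) (d : 'I_r -> nat).
Variables (x u : 'I_r -> monomial C) (x' u' : monomial C).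

Definition rhs_x (i : 'I_r) : seq (monomial C) :=
  [:: mono_scale (- 2%:R) (mono_mul (x i) (u i))].

Definition rhs_u (i : 'I_r) : seq (monomial C) :=
  [:: mono_scale (- 1) (mono_mul (u i) u');
      mono_scale ((d i)%:R)^-1 (x i)].

Definition rhs_x' : seq (monomial C) := [:: mono_mul x' u'].

Definition rhs_u' : seq (monomial C) :=
  [seq mono_scale (- (d k)%:R) (mono_mul (u k) (u k)) | k <- enum 'I_r].

Definition leading_order_balance : Prop :=
  [/\ forall i, balanced (mono_deriv (x i)) (rhs_x i),
      forall i, balanced (mono_deriv (u i)) (rhs_u i),
      balanced (mono_deriv x') rhs_x'
    & balanced (mono_deriv u') rhs_u'].

Definition leading_coefs_neq0 : Prop :=
  [/\ forall i, (x i).1 != 0, forall i, (u i).1 != 0, x'.1 != 0 & u'.1 != 0].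

Definition singular_expansions : Prop :=
  [\/ exists i, (x i).2 < 0, exists i, (u i).2 < 0, x'.2 < 0 | u'.2 < 0].

End System.

(* Main.v *)
(* The equation for x_i with alpha_i <> 0 forces gamma_i = -1 and
   c_i = - alpha_i / 2. The minimal exponent on the right of the equation for
   u_(r+1) is then -2, with coefficient - (1/4) \sum_i d_i alpha_i ^ 2 <> 0, so
   epsilon <= -1, while the equation for x_(r+1) forbids epsilon < -1. Since
   alpha_i > -2, the equation for u_i with i <= l reads - c_i = - c_i e, so
   e = 1, which is the ellipsoid equation. When alpha_i = 0 the equation for x_i
   only says gamma_i > -1, and the one for u_i then leaves only gamma_i = 1.
   Conversely d_i alpha_i ^ 2 <= 4 and d_i >= 2 give alpha_i > -2. *)
Require Import Defs.
From mathcomp Require Import all_boot all_order all_algebra.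
From mathcomp Require Import reals ring lra.

Set Implicit Arguments.
Unset Strict Implicit.
Unset Printing Implicit Defensive.

Import Order.TTheory GRing.Theory Num.Theory.
Local Open Scope ring_scope.

(** * Minimal exponents and the balance of a list of monomials *)

Section Balance.
Variable C : fieldType.
Implicit Types (p q : monomial C) (s : seq (monomial C)).

Lemma min_exponentE m p s :
  m \in [seq q.2 | q <- p :: s] -> all (fun q => m <= q.2) (p :: s) ->
  min_exponent p s = m.
Proof.
move=> m_in /= /andP[m_le_p /allP m_le]; apply/le_anti/andP; split.
  rewrite /min_exponent -(big_map snd xpredT id).
  (* The exponent of the head [p] is the initial value of the iterated minimum, so it is treated
     apart from those of [s]. *)
  move: m_in; rewrite inE => /orP[/eqP-> | m_in]; first exact: bigmin_le_id.
  exact: (@ge_bigmin_seq _ _ _ _ _ _ xpredT id m_in isT).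
rewrite /min_exponent big_seq; apply: (big_ind (fun y => m <= y)) => //.
by move=> y z my mz; rewrite le_min my.
Qed.

(** Lets a balance be read off at a guessed exponent [m], certified as a minimum by being attained
    and being a lower bound. *)
Lemma balancedE m p s :
  m \in [seq q.2 | q <- p :: s] -> all (fun q => m <= q.2) (p :: s) ->
  balanced p s <-> p.1 *+ (p.2 == m) = coef_at m s.
Proof.
move=> m_in m_le; rewrite /balanced (min_exponentE m_in m_le).
by rewrite {1}/coef_at big_cons big_nil; case: ifP => _; rewrite ?addr0.
Qed.

Lemma coef_at_cons m p s : coef_at m (p :: s) = p.1 *+ (p.2 == m) + coef_at m s.
Proof. by rewrite /coef_at big_cons; case: ifP => _; rewrite ?add0r. Qed.

Lemma coef_at_nil m : coef_at m [::] = 0 :> C.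
Proof. by rewrite /coef_at big_nil. Qed.

(** If the two exponents differ, only the lower monomial is seen, and it faces an empty sum. Its
    coefficient may really be zero, since [mono_deriv] annihilates constants. *)
Lemma balanced1P p q :
  balanced p [:: q] <->
  [\/ p.2 < q.2 /\ p.1 = 0, p.2 = q.2 /\ p.1 = q.1 | q.2 < p.2 /\ q.1 = 0].
Proof.
have [lt_pq|lt_qp|eq_pq] := ltgtP p.2 q.2.
- rewrite (balancedE (m := p.2)) ?inE ?eqxx //=; last by rewrite lexx ltW.
  rewrite coef_at_cons coef_at_nil ?eqxx (gt_eqF lt_pq) addr0 mulr0n mulr1n.
  split=> [->|[[]//|[eq_pq]|[]//]]; first by constructor 1.
  by rewrite eq_pq ltxx in lt_pq.
- rewrite (balancedE (m := q.2)) ?inE ?eqxx ?orbT //=; last by rewrite lexx ltW.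
  rewrite coef_at_cons coef_at_nil ?eqxx (gt_eqF lt_qp) addr0 mulr0n mulr1n.
  split=> [<-|[[]//|[eq_pq]|[_ ->]//]]; first by constructor 3.
  by rewrite eq_pq ltxx in lt_qp.
- rewrite (balancedE (m := q.2)) ?inE ?eqxx ?orbT //=;
    last by rewrite eq_pq lexx.
  rewrite coef_at_cons coef_at_nil eq_pq ?eqxx addr0 !mulr1n.
  by split=> [->|[[]|[]|[]]//]; constructor 2.
Qed.

End Balance.

(** * The balance of each equation of the system *)

Section LeadingTerms.
Variables (C : numFieldType) (r : nat) (d : 'I_r -> nat).
Hypothesis d_ge2 : forall i, (2 <= d i)%N.
Variables (l : nat).
Hypotheses (l_gt0 : (0 < l)%N) (l_le_r : (l <= r)%N).
Variables (a c : 'I_r -> C) (b e : C).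
Variables (alpha gamma : 'I_r -> rat) (beta epsilon : rat).

Let x i : monomial C := (a i, alpha i).
Let u i : monomial C := (c i, gamma i).
Let x' : monomial C := (b, beta).
Let u' : monomial C := (e, epsilon).

Let ellipsoid : rat := \sum_(i < r | (i < l)%N) (d i)%:R * alpha i ^+ 2.
(** A witness below [l]: its square term attains exponent -2, keeps the ellipsoid sum positive, and
    its equation for [u] yields [e = 1]. *)
Let i0 : 'I_r := Ordinal (leq_trans l_gt0 l_le_r).

Let ratr_inj : injective (@ratr C) := fmorph_inj _.

Let d_neq0 i : (d i)%:R != 0 :> C.
Proof. by rewrite pnatr_eq0 -lt0n (leq_trans _ (d_ge2 i)). Qed.

Lemma balanced_x_neq0P i : a i != 0 -> c i != 0 -> alpha i != 0 ->
  balanced (mono_deriv (x i)) (rhs_x x u i) <->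
  gamma i = -1 /\ c i = - ratr (alpha i) / 2%:R.
Proof.
move=> a0 c0 al0; rewrite balanced1P /=.
have ral0 : ratr (alpha i) != 0 :> C by rewrite fmorph_eq0.
split=> [[[_ /eqP]|[Hg Hc]|[_ /eqP]]|[-> cE]].
- by rewrite mulf_eq0 (negPf a0) (negPf ral0).
- split; first by lra.
  by apply: (mulfI a0); rewrite mulrA mulrN Hc; field.
- by rewrite !mulf_eq0 oppr_eq0 pnatr_eq0 (negPf a0) (negPf c0).
- by constructor 2; split=> //; rewrite cE; field.
Qed.

(** The derivative is zero but still carries exponent -1; the product, of exponent [gamma i] and
    nonzero coefficient, must lie strictly above it. *)
Lemma balanced_x_eq0P i : a i != 0 -> c i != 0 -> alpha i = 0 ->
  balanced (mono_deriv (x i)) (rhs_x x u i) <-> -1 < gamma i.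
Proof.
move=> a0 c0 al0; rewrite balanced1P /= al0 !add0r rmorph0 mulr0.
have k0 : - 2%:R * (a i * c i) != 0.
  by rewrite !mulf_neq0 // oppr_eq0 pnatr_eq0.
split=> [[[]//|[_ /esym/eqP]|[_ /eqP]]|gt1]; last by constructor 1.
  by rewrite (negPf k0).
by rewrite (negPf k0).
Qed.

(** Both alternatives give [-1 <= epsilon], the bound needed in [balanced_u'P], which then rules out
    the second one. *)
Lemma balanced_x'P : b != 0 -> e != 0 ->
  balanced (mono_deriv x') (rhs_x' x' u') <->
  (epsilon = -1 /\ e = ratr beta) \/ (-1 < epsilon /\ beta = 0).
Proof.
move=> b0 e0; rewrite balanced1P /=; split.
  case=> [[lt_e /eqP]|[eq_e /(mulfI b0) <-]|[_ /eqP]].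
  - rewrite mulf_eq0 (negPf b0) fmorph_eq0 => /eqP be0.
    by right; split=> //; lra.
  - by left; split=> //; lra.
  - by rewrite mulf_eq0 (negPf b0) (negPf e0).
case=> [[-> ->]|[lt_e ->]]; first by constructor 2.
by constructor 1; rewrite rmorph0 mulr0; split=> //; lra.
Qed.

(** The derivative and the product both have exponent -2, below [alpha i], so the term in [x i]
    drops out. *)
Lemma balanced_u_ltP i : gamma i = -1 -> epsilon = -1 -> c i != 0 ->
  -2%:R < alpha i ->
  balanced (mono_deriv (u i)) (rhs_u d x u u' i) <-> e = 1.
Proof.
move=> gi eE c0 al; rewrite (balancedE (m := -2%:R)) /=; first last.
- by rewrite gi eE (ltW al).
- by rewrite !inE gi.
rewrite !coef_at_cons coef_at_nil /= gi eE (gt_eqF al) rmorphN1 mulr0n !addr0.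
have -> : (-1 - 1 == -2%:R :> rat) by [].
rewrite !mulr1n mulN1r mulrN1; split=> [/oppr_inj H|->]; last by rewrite mulr1.
by apply: (mulfI c0); rewrite mulr1.
Qed.

(** The exponents are [gamma i - 1] twice and 0. If [gamma i < 1], the balance forces
    [gamma i = -1], which is excluded; if [gamma i > 1], the term in [x i] stands alone and cannot
    vanish. *)
Lemma balanced_u_geP i : -1 < gamma i -> epsilon = -1 -> e = 1 ->
  alpha i = 0 -> a i != 0 -> c i != 0 ->
  balanced (mono_deriv (u i)) (rhs_u d x u u' i) <->
  gamma i = 1 /\ c i = a i / (2%:R * (d i)%:R).
Proof.
move=> gi eE e1 al a0 c0; have di0 := d_neq0 i.
have [lt1|gt1|eq1] := ltgtP (gamma i) 1.
- rewrite (balancedE (m := gamma i - 1)) /=; first last.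
  + by rewrite eE al !lexx /=; lra.
  + by rewrite !inE eqxx.
  rewrite !coef_at_cons coef_at_nil /= eE al eqxx.
  rewrite (_ : (0 == _) = false); last by apply/eqP => ?; lra.
  rewrite e1 !mulr1n mulr0n !addr0 mulr1 mulN1r; split; last first.
    by case=> ? _; exfalso; lra.
  rewrite -mulrN1 => /(mulfI c0) H.
  have : gamma i = -1 by apply: ratr_inj; rewrite H rmorphN1.
  by move=> ?; exfalso; lra.
- rewrite (balancedE (m := 0)) /=; first last.
  + by rewrite eE al lexx; lra.
  + by rewrite !inE al eqxx !orbT.
  rewrite !coef_at_cons coef_at_nil /= eE al eqxx.
  rewrite (_ : (_ - 1 == _) = false); last by apply/eqP => ?; lra.
  rewrite mulr0n mulr1n addr0 add0r; split=> [/esym/eqP|[? _]];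
    last by exfalso; lra.
  by rewrite mulf_eq0 invr_eq0 (negPf di0) (negPf a0).
- rewrite (balancedE (m := 0)) /=; first last.
  + by rewrite eE al eq1 subrr lexx.
  + by rewrite !inE al eqxx !orbT.
  rewrite !coef_at_cons coef_at_nil /= eE al eq1 subrr eqxx rmorph1 e1.
  rewrite !mulr1n addr0 mulr1 mulN1r; split=> [H|[_ ->]]; last by field.
  (* Here [H] says that [c i] is [- c i] plus the term in [x i]; expanding only the second summand
     cancels the first. *)
  split=> //; have -> : a i = (c i + c i) * (d i)%:R by rewrite {2}H; field.
  by field.
Qed.

(** Squares with index at least [l] have exponent above -2 and do not contribute. *)
Lemma coef_at_rhs_u' :
  (forall i : 'I_r, (i < l)%N ->
    gamma i = -1 /\ c i = - ratr (alpha i) / 2%:R) ->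
  (forall i : 'I_r, (l <= i)%N -> -1 < gamma i) ->
  coef_at (-2%:R) (rhs_u' d u) = - (ratr ellipsoid / 4%:R).
Proof.
move=> Hlt Hge; rewrite /coef_at big_map big_enum_cond /=.
rewrite rmorph_sum mulr_suml -sumrN; apply: eq_big => [i|i].
  case: (ltnP i l) => [/Hlt[-> _]//|/Hge Hg]; apply/eqP => ?; lra.
case: (ltnP i l) => [/Hlt[_ ->] _|/Hge Hg /eqP ?]; last by exfalso; lra.
by rewrite rmorphM rmorphXn /= rmorph_nat; field.
Qed.

Lemma exponents_rhs_u' :
  (forall i : 'I_r, (i < l)%N -> gamma i = -1) ->
  (forall i : 'I_r, (l <= i)%N -> -1 < gamma i) ->
  -2%:R \in [seq q.2 | q <- rhs_u' d u] /\
  all (fun q => -2%:R <= q.2) (rhs_u' d u).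
Proof.
move=> Hlt Hge; split.
  rewrite -map_comp; apply/mapP; exists i0; first by rewrite mem_enum.
  by rewrite /= Hlt.
apply/allP => q /mapP[k _ ->] /=.
by case: (ltnP k l) => [/Hlt->//|/Hge]; lra.
Qed.

Lemma balanced_u'P :
  (forall i : 'I_r, (i < l)%N ->
    gamma i = -1 /\ c i = - ratr (alpha i) / 2%:R) ->
  (forall i : 'I_r, (l <= i)%N -> -1 < gamma i) ->
  ellipsoid != 0 -> -1 <= epsilon ->
  balanced (mono_deriv u') (rhs_u' d u) <->
  epsilon = -1 /\ e = ratr ellipsoid / 4%:R.
Proof.
move=> Hlt Hge ell0 He.
have [m_in m_le] := exponents_rhs_u' (fun i il => (Hlt i il).1) Hge.
rewrite (balancedE (m := -2%:R)) /=; first last.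
- by rewrite m_le andbT; lra.
- by rewrite inE m_in orbT.
rewrite coef_at_rhs_u' //; split=> [|[-> ->]]; last first.
  by rewrite rmorphN1 mulrN1.
(* If [epsilon - 1] is not -2, the left side contributes nothing at the minimum, against the nonzero
   sum on the right. *)
case: eqP => [H|_ /eqP].
  have -> : epsilon = -1 by lra.
  by rewrite rmorphN1 mulrN1 mulr1n => /oppr_inj.
rewrite mulr0n eq_sym oppr_eq0 mulf_eq0 invr_eq0 pnatr_eq0 orbF.
by rewrite fmorph_eq0 (negPf ell0).
Qed.

(** * Bounds from the ellipsoid sum *)

Let ellipsoid_term_le (i : 'I_r) :
  (i < l)%N -> (d i)%:R * alpha i ^+ 2 <= ellipsoid.
Proof.
move=> il; rewrite /ellipsoid (bigD1 i) //= lerDl sumr_ge0 // => k _.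
by rewrite mulr_ge0 ?sqr_ge0 // ler0n.
Qed.

Let ellipsoid_neq0 :
  (forall i : 'I_r, (i < l)%N -> alpha i != 0) -> ellipsoid != 0.
Proof.
move=> al0; rewrite gt_eqF //.
apply: lt_le_trans (ellipsoid_term_le (i := i0) l_gt0).
rewrite mulr_gt0 ?ltr0n ?(leq_trans _ (d_ge2 i0)) //.
by rewrite exprn_even_gt0 //= al0.
Qed.

Let alpha_gtN2 (i : 'I_r) : (i < l)%N -> ellipsoid = 4%:R -> -2%:R < alpha i.
Proof.
move=> il ell4; have := ellipsoid_term_le il; rewrite ell4.
have : 2%:R * alpha i ^+ 2 <= (d i)%:R * alpha i ^+ 2.
  by rewrite ler_wpM2r ?sqr_ge0 // ler_nat.
(* The two bounds give [alpha i ^+ 2 <= 2]. *)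
by rewrite expr2 => *; nra.
Qed.

(** The classification with the ellipsoid equation kept in [rat], where the exponents live. *)
Lemma leading_termsP :
  [/\ leading_coefs_neq0 x u x' u',
      singular_expansions x u x' u',
      forall i : 'I_r, (i < l)%N -> alpha i != 0 /\ -2%:R < alpha i,
      forall i : 'I_r, (l <= i)%N -> alpha i = 0
    & leading_order_balance d x u x' u']
  <->
  [/\ forall i : 'I_r, (i < l)%N ->
        [/\ gamma i = -1, a i != 0 & c i = - ratr (alpha i) / 2%:R],
      forall i : 'I_r, (l <= i)%N ->
        [/\ gamma i = 1, a i != 0 & c i = a i / (2%:R * (d i)%:R)],
      [/\ b != 0, e = 1, beta = 1 & epsilon = -1],
      (forall i : 'I_r, (i < l)%N -> alpha i != 0) /\
      (forall i : 'I_r, (l <= i)%N -> alpha i = 0)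
    & ellipsoid = 4%:R].
Proof.
split.
  case=> -[/= a0 c0 b0 e0] _ al_lt al_ge [bal_x bal_u bal_x' bal_u'].
  have Hlt (i : 'I_r) : (i < l)%N ->
      gamma i = -1 /\ c i = - ratr (alpha i) / 2%:R.
    by move=> il; apply/balanced_x_neq0P => //; case: (al_lt i il).
  have Hge (i : 'I_r) : (l <= i)%N -> -1 < gamma i.
    by move=> li; apply/balanced_x_eq0P => //; apply: al_ge.
  have ell0 : ellipsoid != 0 by apply: ellipsoid_neq0 => i /al_lt[].
  have Hx' := (balanced_x'P b0 e0).1 bal_x'.
  have [eps1 eE] : epsilon = -1 /\ e = ratr ellipsoid / 4%:R.
    by apply/balanced_u'P => //; case: Hx' => -[]; lra.
  have e1 : e = 1.
    apply/(balanced_u_ltP (i := i0)) => //; first by case: (Hlt i0 l_gt0).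
    by case: (al_lt i0 l_gt0).
  (* Since [epsilon = -1], only the alternative [e = ratr beta] survives. *)
  have beta1 : beta = 1.
    case: Hx' => [[_ H]|[? _]]; last by exfalso; lra.
    by apply: ratr_inj; rewrite -H e1 rmorph1.
  split=> //.
  - by move=> i il; case: (Hlt i il).
  - move=> i li.
    have balP := balanced_u_geP (Hge i li) eps1 e1 (al_ge i li) (a0 i) (c0 i).
    by have [-> ->] := balP.1 (bal_u i).
  - by split=> // i /al_lt[].
  - apply: ratr_inj; rewrite rmorph_nat -[LHS](divfK (x := 4%:R)) ?pnatr_eq0 //.
    by rewrite -eE e1 mul1r.
case=> Hlt Hge [b0 e1 beta1 eps1] [al_lt al_ge] ell4.
have a0 i : a i != 0 by case: (ltnP i l) => [/Hlt[]|/Hge[]].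
have c0 i : c i != 0.
  case: (ltnP i l) => il.
    have [_ _ ->] := Hlt i il.
    by rewrite mulf_neq0 ?invr_eq0 ?pnatr_eq0 // oppr_eq0 fmorph_eq0 al_lt.
  have [_ ai ->] := Hge i il.
  by rewrite mulf_neq0 // invr_eq0 mulf_neq0 ?d_neq0 // pnatr_eq0.
have e0 : e != 0 by rewrite e1 oner_eq0.
have al_gt (i : 'I_r) (il : (i < l)%N) : -2%:R < alpha i by apply: alpha_gtN2.
have Hge' (i : 'I_r) : (l <= i)%N -> -1 < gamma i by move=> /Hge[->].
(* The expansions are singular because [epsilon = -1]. *)
split=> //; first by constructor 4; rewrite /= eps1.
  by move=> i il; split; [apply: al_lt | apply: al_gt].
split=> [i|i||].
- case: (ltnP i l) => il; last by apply/balanced_x_eq0P; auto.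
  by apply/balanced_x_neq0P; auto; case: (Hlt i il).
- case: (ltnP i l) => il.
    by apply/balanced_u_ltP; auto; case: (Hlt i il).
  by apply/balanced_u_geP; auto; case: (Hge i il).
- by apply/balanced_x'P => //; left; rewrite beta1 rmorph1.
- apply/balanced_u'P => //; first by move=> i /Hlt[].
  + exact: ellipsoid_neq0.
  + by rewrite eps1.
  + by rewrite e1 ell4 rmorph_nat divff ?pnatr_eq0.
Qed.

End LeadingTerms.

(** * Passage from the rational to the real ellipsoid *)

Theorem proposition4p5 (R : realType) (r : nat) (hr : (2 <= r)%N)
    (d : 'I_r -> nat) (hd : forall i, (2 <= d i)%N)
    (l : nat) (hl1 : (1 <= l)%N) (hlr : (l <= r)%N)
    (a c : 'I_r -> complex R) (b e : complex R)
    (alpha gamma : 'I_r -> rat) (beta epsilon : rat) :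
  let x i := (a i, alpha i) in
  let u i := (c i, gamma i) in
  let x' := (b, beta) in
  let u' := (e, epsilon) in
  [/\ leading_coefs_neq0 x u x' u',
      singular_expansions x u x' u',
      forall i : 'I_r, (i < l)%N -> alpha i != 0 /\ -2%:R < alpha i,
      forall i : 'I_r, (l <= i)%N -> alpha i = 0
    & leading_order_balance d x u x' u']
  <->
  [/\ forall i : 'I_r, (i < l)%N ->
        [/\ gamma i = -1, a i != 0 & c i = - ratr (alpha i) / 2%:R],
      forall i : 'I_r, (l <= i)%N ->
        [/\ gamma i = 1, a i != 0 & c i = a i / (2%:R * (d i)%:R)],
      [/\ b != 0, e = 1, beta = 1 & epsilon = -1],
      (forall i : 'I_r, (i < l)%N -> alpha i != 0) /\
      (forall i : 'I_r, (l <= i)%N -> alpha i = 0)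
    & \sum_(i < r | (i < l)%N) (d i)%:R * (ratr (alpha i) : R) ^+ 2 = 4%:R].
Proof.
move=> x u x' u'; rewrite (leading_termsP hd hl1 hlr).
(* The real sum is the image of the rational one under the injective morphism [ratr], so either
   equation implies the other. *)
have ellE : \sum_(i < r | (i < l)%N) (d i)%:R * (ratr (alpha i) : R) ^+ 2 =
    ratr (\sum_(i < r | (i < l)%N) (d i)%:R * alpha i ^+ 2).
  rewrite rmorph_sum; apply: eq_bigr => i _.
  by rewrite rmorphM rmorphXn /= rmorph_nat.
rewrite ellE; split=> -[Hlt Hge Hb Hal ell]; split=> //.
  by rewrite ell rmorph_nat.
by apply: (fmorph_inj (@ratr R)); rewrite /= ell rmorph_nat.
Qed.
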